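(* The Schrödinger algebra $\mathcal{S}_2$ admits a non-trivial $\mathrm{Hom}$-Lie structure; that is, there exists a linear map $\varphi:\mathcal{S}_2\to\mathcal{S}_2$ which is not a scalar multiple of the identity and satisfies $$[\varphi(x),[y,w]]+[\varphi(y),[w,x]]+[\varphi(w),[x,y]]=0\quad\text{for all }x,y,w\in\mathcal{S}_2.$$
   Context: The Schrödinger algebra $\mathcal{S}_2$ is the complex Lie algebra with basis $\{f,h,e,z,x_1,y_1,x_2,y_2,s_{12}\}$ and brackets, for $i=1,2$, $[e,f]=h$, $[h,e]=2e$, $[f,h]=2f$, $[x_i,y_i]=z$, $[h,x_i]=x_i$, $[h,y_i]=-y_i$, $[e,y_i]=x_i$, $[f,x_i]=y_i$, $[s_{12},x_1]=-x_2$, $[s_{12},x_2]=x_1$, $[s_{12},y_1]=-y_2$, $[s_{12},y_2]=y_1$; all brackets of basis elements not determined by these relations and antisymmetry are zero. A $\mathrm{Hom}$-Lie structure on a Lie algebra $(\mathcal{L},[\cdot,\cdot])$ is given by a linear map $\varphi:\mathcal{L}\to\mathcal{L}$ such that $[\varphi(x),[y,w]]+[\varphi(y),[w,x]]+[\varphi(w),[x,y]]=0$ for all $x,y,w\in\mathcal{L}$. It is called non-trivial if $\varphi$ is not a scalar multiple of the identity. *)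

(* Defs.v *)
From HB Require Import structures.
From mathcomp Require Import all_boot all_order all_algebra.
From mathcomp Require Import reals complex ring.

Set Implicit Arguments.
Unset Strict Implicit.
Unset Printing Implicit Defensive.

Import GRing.Theory.
Local Open Scope ring_scope.

HB.mixin Record isLieAlgebra (K : fieldType) L of GRing.Lmodule K L := {
  lie : L -> L -> L;
  lie_linearl : forall y : L, linear (fun x : L => lie x y);
  lie_linearr : forall x : L, linear (lie x);
  lie_alt : forall x : L, lie x x = 0;
  lie_jacobi : forall x y w : L,
    lie x (lie y w) + lie y (lie w x) + lie w (lie x y) = 0
}.

#[short(type="lieAlgType")]
HB.structure Definition LieAlgebra (K : fieldType) :=
  { L of GRing.Lmodule K L & isLieAlgebra K L }.

Definition hom_lie_structure (K : fieldType) (L : lieAlgType K)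
    (phi : {linear L -> L}) : Prop :=
  forall x y w : L,
    lie (phi x) (lie y w) + lie (phi y) (lie w x) + lie (phi w) (lie x y) = 0.

Definition nontrivial_hom_lie_structure (K : fieldType) (L : lieAlgType K)
    (phi : {linear L -> L}) : Prop :=
  hom_lie_structure phi /\ ~ (exists c : K, forall x : L, phi x = c *: x).

Inductive sch2_basis := b_f | b_h | b_e | b_z | b_x1 | b_y1 | b_x2 | b_y2 | b_s12.

Definition sch2_basis_enum := [:: b_f; b_h; b_e; b_z; b_x1; b_y1; b_x2; b_y2; b_s12].

Definition nat_of_sch2_basis (a : sch2_basis) : nat :=
  match a with
  | b_f => 0 | b_h => 1 | b_e => 2 | b_z => 3
  | b_x1 => 4 | b_y1 => 5 | b_x2 => 6 | b_y2 => 7 | b_s12 => 8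
  end.

Lemma nat_of_sch2_basisK :
  pcancel nat_of_sch2_basis (fun n => nth None (map Some sch2_basis_enum) n).
Proof. by case. Qed.

HB.instance Definition _ := Countable.copy sch2_basis
  (pcan_type nat_of_sch2_basisK).

Lemma sch2_basis_enumP : Finite.axiom sch2_basis_enum.
Proof. by case. Qed.

HB.instance Definition _ := isFinite.Build sch2_basis sch2_basis_enumP.

(* sch2_rel a b c is the coefficient of c in the relation listed for [a, b],
   and 0 if [a, b] is not a left-hand side in the defining list. *)
Definition sch2_rel (a b c : sch2_basis) : int :=
  match a, b, c with
  | b_e, b_f, b_h => 1
  | b_h, b_e, b_e => 2
  | b_f, b_h, b_f => 2
  | b_x1, b_y1, b_z => 1          | b_x2, b_y2, b_z => 1
  | b_h, b_x1, b_x1 => 1          | b_h, b_x2, b_x2 => 1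
  | b_h, b_y1, b_y1 => -1         | b_h, b_y2, b_y2 => -1
  | b_e, b_y1, b_x1 => 1          | b_e, b_y2, b_x2 => 1
  | b_f, b_x1, b_y1 => 1          | b_f, b_x2, b_y2 => 1
  | b_s12, b_x1, b_x2 => -1       | b_s12, b_x2, b_x1 => 1
  | b_s12, b_y1, b_y2 => -1       | b_s12, b_y2, b_y1 => 1
  | _, _, _ => 0
  end.

(* No pair is listed in both orders, so antisymmetrizing recovers the
   listed brackets. *)
Definition sch2_const (a b c : sch2_basis) : int :=
  sch2_rel a b c - sch2_rel b a c.

Section Schrodinger2.
Variable K : fieldType.

Definition schrodinger2 := {ffun sch2_basis -> K^o}.

HB.instance Definition _ := GRing.Lmodule.on schrodinger2.

Definition sch2_vec (a : sch2_basis) : schrodinger2 := [ffun c => (c == a)%:R].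

Definition sch2_bracket (u v : schrodinger2) : schrodinger2 :=
  [ffun c => \sum_a \sum_b (u a * v b) * (sch2_const a b c)%:~R].

Lemma sch2_bracket_vec (a b : sch2_basis) :
  sch2_bracket (sch2_vec a) (sch2_vec b) =
  \sum_c (sch2_const a b c)%:~R *: sch2_vec c.
Proof.
apply/ffunP=> c; rewrite sum_ffunE ffunE (bigD1 a) //= (bigD1 b) //=.
rewrite [RHS](bigD1 c) //= !big1 ?addr0.
- by rewrite !ffunE !eqxx !mul1r /GRing.scale /= mulr1.
- by move=> d; rewrite !ffunE eq_sym => /negbTE ->; rewrite /GRing.scale /= mulr0.
- by move=> d /negbTE da; rewrite big1 // => d' _; rewrite !ffunE da !mul0r.
- by move=> d /negbTE db; rewrite !ffunE db mulr0 mul0r.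
Qed.

Lemma sch2_linearl (v : schrodinger2) : linear (fun u => sch2_bracket u v).
Proof.
move=> k u u'; apply/ffunP=> c; rewrite !ffunE /GRing.scale /=.
rewrite mulr_sumr -big_split; apply: eq_bigr => a _ /=.
rewrite mulr_sumr -big_split; apply: eq_bigr => b _ /=.
by rewrite !ffunE /GRing.scale /=; ring.
Qed.

Lemma sch2_linearr (u : schrodinger2) : linear (sch2_bracket u).
Proof.
move=> k v v'; apply/ffunP=> c; rewrite !ffunE /GRing.scale /=.
rewrite mulr_sumr -big_split; apply: eq_bigr => a _ /=.
rewrite mulr_sumr -big_split; apply: eq_bigr => b _ /=.
by rewrite !ffunE /GRing.scale /=; ring.
Qed.

Definition sch2_coord (u v : schrodinger2) (c : sch2_basis) : K :=
  match c with
  | b_f => 2 * (u b_f * v b_h - u b_h * v b_f)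
  | b_h => u b_e * v b_f - u b_f * v b_e
  | b_e => 2 * (u b_h * v b_e - u b_e * v b_h)
  | b_z => u b_x1 * v b_y1 - u b_y1 * v b_x1 + (u b_x2 * v b_y2 - u b_y2 * v b_x2)
  | b_x1 => u b_h * v b_x1 - u b_x1 * v b_h + (u b_e * v b_y1 - u b_y1 * v b_e)
          + (u b_s12 * v b_x2 - u b_x2 * v b_s12)
  | b_x2 => u b_h * v b_x2 - u b_x2 * v b_h + (u b_e * v b_y2 - u b_y2 * v b_e)
          - (u b_s12 * v b_x1 - u b_x1 * v b_s12)
  | b_y1 => u b_y1 * v b_h - u b_h * v b_y1 + (u b_f * v b_x1 - u b_x1 * v b_f)
          + (u b_s12 * v b_y2 - u b_y2 * v b_s12)
  | b_y2 => u b_y2 * v b_h - u b_h * v b_y2 + (u b_f * v b_x2 - u b_x2 * v b_f)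
          - (u b_s12 * v b_y1 - u b_y1 * v b_s12)
  | b_s12 => 0
  end.

Lemma sch2_bracketE (u v : schrodinger2) c :
  sch2_bracket u v c = sch2_coord u v c.
Proof.
rewrite ffunE; case: c; rewrite /index_enum !unlock /= /sch2_const /=; ring.
Qed.

Lemma sch2_alt (u : schrodinger2) : sch2_bracket u u = 0.
Proof.
by apply/ffunP=> c; rewrite sch2_bracketE [RHS]ffunE; case: c => /=; ring.
Qed.

Lemma sch2_jacobi (u v w : schrodinger2) :
  sch2_bracket u (sch2_bracket v w) + sch2_bracket v (sch2_bracket w u)
  + sch2_bracket w (sch2_bracket u v) = 0.
Proof.
apply/ffunP=> c; rewrite [RHS]ffunE 2!ffunE !sch2_bracketE.
by case: c; rewrite /= ?sch2_bracketE /=; ring.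
Qed.

HB.instance Definition _ := isLieAlgebra.Build K schrodinger2
  sch2_linearl sch2_linearr sch2_alt sch2_jacobi.

End Schrodinger2.

(* Main.v *)
Require Import Defs.
From HB Require Import structures.
From mathcomp Require Import all_boot all_order all_algebra.
From mathcomp Require Import reals complex ring.

(** The element [z] is central: it appears in no left-hand side of the defining
    relations. Every term of the Hom-Lie identity is a bracket whose first
    argument lies in the image of [phi], so each linear map with values in the
    centre satisfies the identity term by term. It remains to choose a nonzero
    linear functional and multiply it by [z]: the resulting map has rank one on
    a space of dimension nine, hence is not a scalar. The functional taken here
    is the [s12]-coordinate, so that [s12] goes to [z], which is visibly not a
    multiple of [s12]. *)

Import GRing.Theory.
Local Open Scope ring_scope.

Lemma lieZl (K : fieldType) (L : lieAlgType K) (c : K) (x y : L) :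
  lie (c *: x) y = c *: lie x y.
Proof.
have lie0l : lie (0 : L) y = 0.
  by have := lie_linearl y (-1) 0 0; rewrite scaler0 addr0 scaleN1r addNr.
by have := lie_linearl y c x 0; rewrite lie0l !addr0.
Qed.

Lemma central_image_hom_lie_structure (K : fieldType) (L : lieAlgType K)
    (phi : {linear L -> L}) :
  (forall x y : L, lie (phi x) y = 0) -> hom_lie_structure phi.
Proof. by move=> central x y w; rewrite !central !addr0. Qed.

Section Schrodinger2Center.
Variable K : fieldType.
Local Notation S2 := (schrodinger2 K).

Lemma lie_z (v : S2) : lie (sch2_vec K b_z : S2) v = 0.
Proof.
apply/ffunP => c; rewrite [RHS]ffunE [LHS]sch2_bracketE.
by case: c; rewrite /= ?ffunE /=; ring.
Qed.

Definition s12_to_z (u : S2) : S2 := u b_s12 *: sch2_vec K b_z.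

Lemma s12_to_z_linear : linear s12_to_z.
Proof.
by move=> k u v; rewrite /s12_to_z !ffunE scalerDl -scalerA.
Qed.

HB.instance Definition _ :=
  GRing.isLinear.Build K S2 S2 _ s12_to_z s12_to_z_linear.

Lemma lie_s12_to_z (u v : S2) : lie (s12_to_z u) v = 0.
Proof. by rewrite lieZl lie_z scaler0. Qed.

Lemma s12_to_z_not_scalar :
  ~ (exists c : K, forall u : S2, s12_to_z u = c *: u).
Proof.
case=> c /(_ (sch2_vec K b_s12)) /ffunP /(_ b_z).
rewrite !ffunE /= /GRing.scale /= mulr1 mulr0.
by move/eqP; rewrite oner_eq0.
Qed.

End Schrodinger2Center.

Theorem corollary3p9 (R : realType) :
  exists phi : {linear schrodinger2 R[i] -> schrodinger2 R[i]},
    nontrivial_hom_lie_structure phi.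
Proof.
exists (@s12_to_z R[i]); split; last exact: s12_to_z_not_scalar.
exact/central_image_hom_lie_structure/lie_s12_to_z.
Qed.
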